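(* Let $0\le\theta<1$ be fixed. For each $n$, let $\mathbf{X}=(X_1,\dots,X_n)^\top$ follow the Curie--Weiss model $\mathbb{P}_{\theta,\boldsymbol{\mu}}$, let $\bar X=\frac1n\sum_{i=1}^n X_i$, and consider testing $H_0:\boldsymbol{\mu}=\mathbf{0}$ versus $H_1:\boldsymbol{\mu}\in\Xi(s,B)$, where $s=s_n$ and $B=B_n$ may depend on $n$. (i) If $s\tanh(B)\gg n^{1/2}$, then, for a diverging sequence $L_n\to\infty$ such that $L_n=o(n^{-1/2}s\tanh(B))$, the test that rejects $H_0$ if and only if $\sqrt n\,\bar X\ge L_n$ is asymptotically powerful. (ii) Conversely, if $s\tanh(B)=O(n^{1/2})$, then there is no asymptotically powerful test for this testing problem.
   Context: The Curie--Weiss model with parameters $\theta\in\mathbb{R}$ and $\boldsymbol{\mu}=(\mu_1,\dots,\mu_n)^\top\in\mathbb{R}^n$ is the probability distribution on $\{\pm1\}^n$ given by $$\mathbb{P}_{\theta,\boldsymbol{\mu}}(\mathbf{X}=\mathbf{x})=\frac{1}{Z(\theta,\boldsymbol{\mu})}\exp\Big(\frac{\theta}{n}\sum_{1\le i<j\le n}x_ix_j+\sum_{i=1}^n\mu_ix_i\Big),\qquad \mathbf{x}\in\{\pm1\}^n,$$ where $Z(\theta,\boldsymbol{\mu})$ is the normalizing constant. For $s\in\{1,\dots,n\}$ and $B>0$, $$\Xi(s,B)=\Big\{\boldsymbol{\mu}\in\mathbb{R}^n: |\mathrm{supp}(\boldsymbol{\mu})|=s,\ \min_{i\in\mathrm{supp}(\boldsymbol{\mu})}\mu_i\ge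 B\Big\},\qquad \mathrm{supp}(\boldsymbol{\mu})=\{1\le i\le n:\mu_i\neq0\}.$$ A test is a function $T:\{\pm1\}^n\to\{0,1\}$, where the value $1$ means rejecting $H_0$. Its worst-case risk is $$\mathrm{Risk}(T)=\mathbb{P}_{\theta,\mathbf{0}}(T(\mathbf{X})=1)+\sup_{\boldsymbol{\mu}\in\Xi(s,B)}\mathbb{P}_{\theta,\boldsymbol{\mu}}(T(\mathbf{X})=0).$$ A sequence of tests (indexed by $n$) is asymptotically powerful if $\limsup_{n\to\infty}\mathrm{Risk}(T)=0$. All asymptotics are as $n\to\infty$; $a_n\gg b_n$ means $b_n=o(a_n)$. *)

(* Defs.v *)
From mathcomp Require Import all_boot all_order all_algebra.
From mathcomp Require Import all_classical all_reals all_analysis.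
Import Order.TTheory GRing.Theory Num.Theory.
Import numFieldNormedType.Exports.

Set Implicit Arguments.
Unset Strict Implicit.
Unset Printing Implicit Defensive.

Local Open Scope classical_set_scope.
Local Open Scope ring_scope.

Definition tanh {R : realType} (x : R) : R :=
  (expR x - expR (- x)) / (expR x + expR (- x)).

(* A point of {-1,+1}^n is encoded by booleans, [true] standing for +1 and
   [false] for -1. *)
Definition config (n : nat) := {ffun 'I_n -> bool}.

Definition spin {R : realType} (n : nat) (x : config n) (i : 'I_n) : R :=
  if x i then 1 else -1.

Section CurieWeiss.
Context {R : realType} (n : nat).
Implicit Types (theta B : R) (mu : 'rV[R]_n) (x : config n).

Definition cw_weight theta mu x : R :=
  expR (theta / n%:R * (\sum_(i < n) \sum_(j < n | (i < j)%N) spin x i * spin x j)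
        + \sum_(i < n) mu 0 i * spin x i).

Definition cw_Z theta mu : R := \sum_x cw_weight theta mu x.

Definition cw_pmf theta mu x : R := cw_weight theta mu x / cw_Z theta mu.

Definition cw_prob theta mu (A : pred (config n)) : R :=
  \sum_(x | A x) cw_pmf theta mu x.

Definition supp mu : {set 'I_n} := [set i | mu 0 i != 0]%SET.

Definition Xi (s : nat) B : set 'rV[R]_n :=
  [set mu | #|supp mu| = s /\ forall i, i \in supp mu -> B <= mu 0 i].

Definition xbar x : R := n%:R^-1 * \sum_(i < n) spin x i.

(* [sup] ranges over a set of reals in [0, 1], nonempty as soon as
   1 <= s <= n. *)
Definition risk theta (s : nat) B (T : config n -> bool) : R :=
  cw_prob theta 0 (fun x => T x)
  + sup [set cw_prob theta mu (fun x => ~~ T x) | mu in Xi s B].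

End CurieWeiss.

Definition asymptotically_powerful {R : realType} (theta : R) (s : nat -> nat)
    (B : nat -> R) (T : forall n, config n -> bool) : Prop :=
  limn_esup (fun n => (risk theta (s n) (B n) (T n))%:E) = 0%E.

(* Main.v *)
(* Let S = \sum_i x_i and D = \sum_i (x_i - tanh a_i), where
   a_i = theta / n * (S - x_i) + mu_i is the local field at i, so that tanh a_i
   is the conditional mean of x_i given the other spins.  Flipping the spin x_i
   turns weight * (x_i - tanh a_i) into its opposite and changes D by O(1),
   whence E D^2 <= 4 n for every mu.  As tanh is nondecreasing and 1-Lipschitz,
   D <= r + theta - \sum_i tanh mu_i when S <= r with r >= 0, and
   D >= (1 - theta) S - theta - \sum_i tanh mu_i when S >= 0; Chebyshev's
   inequality for D then bounds both error probabilities in (i).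

   For (ii), put the uniform prior on the s-subsets carrying the signal B, and
   let t = tanh B.  Writing exp (B x_i) = cosh B (1 + t x_i), Griffiths'
   inequality bounds the ratio of partition functions below by (cosh B)^s, and
   Maclaurin's inequality bounds the average of the products of s factors
   1 + t x_i by (1 + t S / n)^s <= exp (s t S / n).  So the likelihood ratio is
   bounded where S = O(sqrt n), an event which, by the lower bound on D, has
   probability close to 1 under the mixture. *)
Require Import Defs.
From mathcomp Require Import all_boot all_order all_algebra all_fingroup.
From mathcomp Require Import all_classical all_reals all_analysis.
From mathcomp Require Import ring lra.
Import Order.TTheory GRing.Theory Num.Theory.
Import numFieldNormedType.Exports.
Local Open Scope classical_set_scope.
Local Open Scope ring_scope.

(** * The hyperbolic tangent: parity, monotonicity, slope at most 1 *)

Section Tanh.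
Context {R : realType}.
Implicit Types x y b t : R.

Lemma expR_cosh_gt0 x : 0 < expR x + expR (- x).
Proof. by rewrite addr_gt0 ?expR_gt0. Qed.

Lemma tanh0 : tanh 0 = 0 :> R.
Proof. by rewrite /tanh oppr0 subrr mul0r. Qed.

Lemma tanhN x : tanh (- x) = - tanh x.
Proof. by rewrite /tanh opprK -mulNr opprB; congr (_ / _); rewrite addrC. Qed.

Lemma tanh_lt1 x : tanh x < 1.
Proof.
rewrite /tanh ltr_pdivrMr ?expR_cosh_gt0//; have := expR_gt0 (- x); lra.
Qed.

Lemma tanh_gtN1 x : -1 < tanh x.
Proof. by rewrite ltrNl -tanhN tanh_lt1. Qed.

(** A single spin in field x equals +1 or -1 with probability (1 + tanh x) / 2 or (1 - tanh x) / 2,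
    so this is detailed balance for its flip. *)
Lemma tanh_flip x : 1 - tanh x = expR (- (2 * x)) * (1 + tanh x).
Proof.
have -> : - (2 * x) = - x + - x by ring.
have e0 := expR_gt0 x; rewrite expRD /tanh !expRN; field.
by rewrite !lt0r_neq0//; nra.
Qed.

Lemma is_derive_tanh x : is_derive x 1 (@tanh R) (1 - tanh x ^+ 2).
Proof.
have cx : expR x + expR (- x) != 0 by rewrite gt_eqF// expR_cosh_gt0.
apply: trigger_derive; rewrite /GRing.scale /= /tanh; field.
exact: cx.
Qed.

(** Mean value theorem: the derivative 1 - tanh^2 lies in [0, 1]. *)
Lemma tanh_increment b y : 0 <= y -> tanh b <= tanh (b + y) <= tanh b + y.
Proof.
move=> y0; have le_b : b <= b + y by rewrite lerDl.
have [|z _] := MVT_segment le_b (fun x _ => is_derive_tanh x).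
  apply: continuous_subspaceT => x.
  exact/differentiable_continuous/derivable1_diffP/(@ex_derive _ _ _ _ _ _ _ (is_derive_tanh x)).
rewrite [b + y - b]addrAC subrr add0r => E.
have := tanh_lt1 z; have := tanh_gtN1 z; set t := tanh z in E * => t1 t2.
have /andP[u0 u1] : 0 <= 1 - t ^+ 2 <= 1 by apply/andP; split; nra.
have := mulr_ge0 u0 y0; have := ler_piMl y0 u1; lra.
Qed.

Lemma tanh_le b y : b <= y -> tanh b <= tanh y.
Proof.
move=> le_by; have := @tanh_increment b (y - b); rewrite subr_ge0 => /(_ le_by).
by rewrite addrC subrK => /andP[].
Qed.

(** The shift [y] may be negative: monotonicity first replaces it by [z]. For negative [z], a slope
    at most 1 would bound in the wrong direction. *)
Lemma tanh_addr_le b y z : y <= z -> 0 <= z -> tanh (b + y) <= tanh b + z.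
Proof.
move=> yz z0; have /andP[_] := @tanh_increment b z z0.
by apply: le_trans; rewrite tanh_le// lerD2l.
Qed.

Lemma tanh_addr_ge b y z : z <= y -> z <= 0 -> tanh b + z <= tanh (b + y).
Proof.
move=> zy z0; rewrite -lerN2 -tanhN !opprD -tanhN.
by apply: tanh_addr_le; rewrite ?lerN2 ?oppr_ge0.
Qed.

Lemma tanh_lipschitz x y : `|tanh x - tanh y| <= `|x - y|.
Proof.
wlog le_yx : x y / y <= x => [H|].
  by case/orP: (le_total y x) => /H//; rewrite distrC [leRHS]distrC.
have := @tanh_increment y (x - y); rewrite subr_ge0 => /(_ le_yx).
rewrite addrC subrK => /andP[lo hi].
by rewrite !ger0_norm ?subr_ge0// lerBlDl.
Qed.

Lemma norm_tanh_lt1 x : `|tanh x| < 1.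
Proof. by rewrite ltr_norml tanh_lt1 tanh_gtN1. Qed.

Lemma tanh_gt0 x : 0 < x -> 0 < tanh x.
Proof.
move=> x0; rewrite /tanh divr_gt0 ?expR_cosh_gt0// subr_gt0 ltr_expR.
lra.
Qed.

(** Any function of a sign is affine in it; here the constant term is cosh a and the slope sinh
    a. *)
Lemma expR_sign (a e : R) : e = 1 \/ e = -1 ->
  expR (a * e) = (expR a + expR (- a)) / 2 * (1 + tanh a * e).
Proof.
have c0 : expR a + expR (- a) != 0 by rewrite gt_eqF// expR_cosh_gt0.
by case=> ->; rewrite ?mulrN1 ?mulr1 /tanh; field.
Qed.

Lemma tanh_ge0 x : 0 <= x -> 0 <= tanh x.
Proof. by move=> x0; rewrite -[leLHS]tanh0 tanh_le. Qed.

End Tanh.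

(** * Griffiths' inequality for ferromagnetic weights *)

Section Griffiths.
Context {R : realType} {n : nat}.
Implicit Types (f : config n -> R) (l : seq 'I_n) (a b t theta : R).

Lemma spinP (x : config n) i : spin x i = 1 :> R \/ spin x i = -1 :> R.
Proof. by rewrite /spin; case: (x i); [left|right]. Qed.

Lemma spin_mulK (x : config n) i : spin x i * spin x i = 1 :> R.
Proof. by case: (spinP x i) => ->; rewrite ?mulrNN mulr1. Qed.

(* [l] is a list, with repetitions, rather than a set, so that products of spins
   multiply by concatenation. *)
Definition ferromagnetic f :=
  forall l, 0 <= \sum_x f x * \prod_(i <- l) (spin x i : R).

(** The sum factorizes over the sites, and a site occurring m times in [l] contributes 1 + (-1)^m,
    which is 0 or 2. *)
Lemma ferromagnetic_cst1 : ferromagnetic (fun=> 1).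
Proof.
move=> l.
have E (x : config n) :
    \prod_(i <- l) spin x i = \prod_i (spin x i : R) ^+ count_mem i l.
  elim: l => [|i l IH]; first by rewrite big_nil big1.
  rewrite big_cons IH /=; under [RHS]eq_bigr do rewrite exprD.
  rewrite big_split /=; congr (_ * _); rewrite (bigD1 i) //= eqxx big1 ?mulr1//.
  by move=> j /negPf; rewrite eq_sym => ->.
under eq_bigr do rewrite mul1r E.
rewrite -(bigA_distr_bigA (fun i (b : bool) => (if b then 1 else -1 : R) ^+ count_mem i l)).
apply: prodr_ge0 => i _; rewrite big_bool /= expr1n -signr_odd.
by case: odd; rewrite ?expr1 ?subrr// expr0 addr_ge0.
Qed.

Lemma ferromagnetic_mul f a b r : 0 <= a -> 0 <= b ->
  ferromagnetic f ->
  ferromagnetic (fun x => (a + b * \prod_(i <- r) spin x i) * f x).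
Proof.
move=> a0 b0 Pf l.
have -> : \sum_x (a + b * \prod_(i <- r) spin x i) * f x * \prod_(i <- l) spin x i =
  a * \sum_x f x * \prod_(i <- l) spin x i
  + b * \sum_x f x * \prod_(i <- r ++ l) spin x i.
  rewrite !mulr_sumr -big_split; apply: eq_bigr => x _ /=; rewrite big_cat /=.
  ring.
by rewrite addr_ge0 ?mulr_ge0.
Qed.

(** The product of two spins is a sign, so [expR_sign] makes the exponential a constant plus a
    nonnegative multiple of that product, as in [ferromagnetic_mul]. *)
Lemma ferromagnetic_pair f a i j : 0 <= a -> ferromagnetic f ->
  ferromagnetic (fun x => expR (a * (spin x i * spin x j)) * f x).
Proof.
move=> a0 Pf.
pose c : R := (expR a + expR (- a)) / 2.
have c0 : 0 <= c by rewrite divr_ge0// ltW// expR_cosh_gt0.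
have P := @ferromagnetic_mul f c (c * tanh a) [:: i; j] c0 (mulr_ge0 c0 (tanh_ge0 _ a0)) Pf.
move=> l; have := P l; congr (0 <= _); apply: eq_bigr => x _.
rewrite !big_cons big_nil mulr1 expR_sign; first by rewrite -/c; ring.
by case: (spinP x i) => ->; case: (spinP x j) => ->; rewrite ?mulrNN ?mulr1 ?mul1r; auto.
Qed.

Lemma ferromagnetic_expR_pairs a (r : seq ('I_n * 'I_n)) : 0 <= a ->
  ferromagnetic (fun x => expR (a * \sum_(p <- r) spin x p.1 * spin x p.2)).
Proof.
move=> a0; elim: r => [|p r IH].
  move=> l; have := ferromagnetic_cst1 l; congr (0 <= _).
  by apply: eq_bigr => x _; rewrite big_nil mulr0 expR0.
move=> l; have := ferromagnetic_pair _ _ p.1 p.2 a0 IH l; congr (0 <= _).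
by apply: eq_bigr => x _; rewrite big_cons mulrDr expRD.
Qed.

Lemma ferromagnetic_cw theta : 0 <= theta ->
  ferromagnetic (cw_weight (n := n) theta 0).
Proof.
move=> t0 l.
have := @ferromagnetic_expR_pairs (theta / n%:R)
  [seq p : 'I_n * 'I_n <- index_enum _ | (p.1 < p.2)%N] _ l.
rewrite divr_ge0// => /(_ isT); congr (0 <= _); apply: eq_bigr => x _.
congr (_ * _); rewrite /cw_weight [X in _ + X]big1 => [|i _]; last by rewrite mxE mul0r.
by rewrite addr0 big_filter pair_big_dep.
Qed.


(** Each new factor 1 + t x_i raises the sum by t times the correlation of x_i with the current
    weight. This is nonnegative because that weight is ferromagnetic, so both conclusions are
    carried through one induction. *)
Lemma ferromagnetic_prod f t l : 0 <= t -> ferromagnetic f ->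
  ferromagnetic (fun x => \prod_(i <- l) (1 + t * spin x i) * f x)
  /\ \sum_x f x <= \sum_x \prod_(i <- l) (1 + t * spin x i) * f x.
Proof.
move=> t0 Pf; elim: l => [|i l [IH le_f]].
  split; last by apply/ler_sum => x _; rewrite big_nil mul1r.
  by move=> l; have := Pf l; congr (0 <= _); apply: eq_bigr => x _; rewrite big_nil mul1r.
split.
  have P := @ferromagnetic_mul _ 1 t [:: i] ler01 t0 IH.
  move=> l'; have := P l'; congr (0 <= _); apply: eq_bigr => x _.
  by rewrite !big_cons big_nil mulr1 !mulrA.
apply: (le_trans le_f); under [leRHS]eq_bigr do rewrite big_cons.
rewrite -subr_ge0 -sumrB.
have := mulr_ge0 t0 (IH [:: i]); rewrite mulr_sumr; congr (0 <= _).
by apply: eq_bigr => x _; rewrite big_cons big_nil; ring.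
Qed.

End Griffiths.

(** * Maclaurin's inequality, in the form of averages over permutations *)

Section Maclaurin.
Context {R : realType} {n : nat} (y : 'I_n -> R).
Hypothesis y0 : forall i, 0 <= y i.
Implicit Types (sg : 'S_n) (s : nat).

(* Averaged over permutations, y_s may be traded for any y_k: for k >= s this is
   exact, and for k < s the swap of k and s gives
   2 y_k y_s <= y_k^2 + y_s^2. *)
Lemma sum_perm_prod_le_step s (W := fun sg : 'S_n => \prod_(k < n | (k < s)%N) y (sg k)) :
  (s < n)%N ->
  \sum_(sg : 'S_n) \prod_(k < n | (k < s.+1)%N) y (sg k) <=
  (n%:R^-1 * \sum_i y i) * \sum_(sg : 'S_n) W sg.
Proof.
move=> sn; pose a := Ordinal sn.
have Ws sg : \prod_(k < n | (k < s.+1)%N) y (sg k) = W sg * y (sg a).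
  rewrite (bigD1 a) //= mulrC; congr (_ * _); apply: eq_bigl => k.
  by rewrite ltnS leq_eqVlt -val_eqE /=; case: ltngtP.
under eq_bigr do rewrite Ws.
(* It suffices to average [H] over all positions k, since for each permutation the values y (sg k)
   add up to the sum of all y. *)
suff H k : \sum_(sg : 'S_n) W sg * y (sg a) <= \sum_(sg : 'S_n) W sg * y (sg k).
  have n0 : (0 : R) < n%:R by rewrite ltr0n (leq_ltn_trans _ sn).
  rewrite -mulrA ler_pdivlMl//.
  have -> : (\sum_i y i) * \sum_(sg : 'S_n) W sg = \sum_(k < n) \sum_(sg : 'S_n) W sg * y (sg k).
    rewrite exchange_big /= mulr_sumr; apply: eq_bigr => sg _.
    rewrite -mulr_sumr mulrC; congr (_ * _).
    by rewrite (reindex_inj (@perm_inj _ sg)).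
  have := ler_sum (index_enum 'I_n) (P := xpredT) (fun k _ => H k).
  by rewrite sumr_const card_ord mulr_natl.
have swap (F : 'S_n -> R) : \sum_(sg : 'S_n) F sg = \sum_(sg : 'S_n) F (tperm a k * sg)%g.
  by rewrite (reindex_inj (mulgI (tperm a k))).
have [ks|ks] := ltnP k s; last first.
  rewrite [leRHS]swap; apply: ler_sum => sg _.
  rewrite permM tpermR /W ler_wpM2r//; apply: ler_prod => j js.
  by rewrite y0 permM tpermD ?lexx//; apply: contraTneq js => <-; rewrite -leqNgt.
(* [V] is the part of [W] that the swap leaves unchanged, so symmetrizing turns the right side into
   y_k^2 + y_s^2 times [V]. *)
pose V sg := \prod_(j < n | (j < s)%N && (j != k)) y (sg j).
have WV sg : W sg = y (sg k) * V sg by rewrite /W (bigD1 k).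
have Vsw sg : V (tperm a k * sg)%g = V sg.
  apply: eq_bigr => j /andP[js jk]; rewrite permM tpermD// 1?eq_sym//.
  by apply: contraTneq js => ->; rewrite ltnn.
suff : \sum_(sg : 'S_n) 2 * (W sg * y (sg a)) <= \sum_(sg : 'S_n) 2 * (W sg * y (sg k)).
  by rewrite -!mulr_sumr ler_pM2l.
have -> : \sum_(sg : 'S_n) 2 * (W sg * y (sg k)) =
    \sum_(sg : 'S_n) (y (sg k) ^+ 2 + y (sg a) ^+ 2) * V sg.
  rewrite -mulr_sumr mulr_natl mulr2n {2}swap -big_split; apply: eq_bigr => sg _ /=.
  rewrite !WV Vsw !permM tpermR; ring.
apply: ler_sum => sg _; rewrite WV.
have V0 : 0 <= V sg by apply: prodr_ge0.
have := mulr_ge0 (sqr_ge0 (y (sg k) - y (sg a))) V0; nra.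
Qed.

Lemma sum_perm_prod_le s : (s <= n)%N ->
  \sum_(sg : 'S_n) \prod_(k < n | (k < s)%N) y (sg k) <=
  (n%:R^-1 * \sum_i y i) ^+ s * \sum_(sg : 'S_n) 1.
Proof.
elim: s => [_|s IH sn].
  by rewrite expr0 mul1r; apply: ler_sum => sg _; rewrite big_pred0.
apply: (le_trans (sum_perm_prod_le_step _ sn)); rewrite exprS -[leRHS]mulrA.
by rewrite ler_wpM2l ?IH 1?ltnW// mulr_ge0 ?invr_ge0// sumr_ge0.
Qed.

End Maclaurin.

(** * Spin flips, the second moment of the total residual, and its link to the magnetization *)

Section Model.
Context {R : realType} {n : nat}.
Variables (theta : R) (mu : 'rV[R]_n).
Hypothesis theta01 : 0 <= theta < 1.
Implicit Types (x : config n) (i j : 'I_n).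

Definition mag x : R := \sum_i spin x i.

Definition flip i x : config n := [ffun j => (j == i) (+) x j].

Lemma flipK i : involutive (flip i).
Proof. by move=> x; apply/ffunP => j; rewrite !ffunE addbA addbb. Qed.

Lemma spin_flip i x j : spin (flip i x) j = (if j == i then - spin x j else spin x j) :> R.
Proof. by rewrite /spin ffunE; case: eqP => _; case: (x j); rewrite ?opprK. Qed.

Lemma mag_flip i x : mag (flip i x) = mag x - 2 * spin x i.
Proof.
rewrite /mag (bigD1 i)//= [in RHS](bigD1 i)//= spin_flip eqxx.
rewrite [X in - _ + X](eq_bigr (spin x)); first by ring.
by move=> j /negPf ji; rewrite spin_flip ji.
Qed.

Lemma sum_spin_pairs x :
  \sum_(i < n) \sum_(j < n | (i < j)%N) spin x i * spin x j = (mag x ^+ 2 - n%:R) / 2.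
Proof.
set P := (X in X = _).
have -> : mag x ^+ 2 = P + n%:R + P; last by field.
rewrite expr2 {1}/mag mulr_suml.
have {2}-> : P = \sum_(i < n) \sum_(j < n | (j < i)%N) spin x i * spin x j.
  rewrite /P (exchange_big_dep xpredT)//=; apply: eq_bigr => i _.
  by apply: eq_bigr => j _; rewrite mulrC.
have -> : n%:R = \sum_(i < n) spin x i * spin x i :> R.
  by under eq_bigr do rewrite spin_mulK; rewrite sumr_const card_ord.
rewrite /P -!big_split; apply: eq_bigr => i _ /=; rewrite /mag mulr_sumr.
rewrite (bigID (fun j : 'I_n => (i < j)%N))/= -addrA; congr (_ + _).
rewrite (bigD1 i) ?ltnn//=; congr (_ + _); apply: eq_bigl => j.
by rewrite -leqNgt ltn_neqAle andbC.
Qed.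

Lemma cw_weightE x : cw_weight theta mu x =
  expR (theta / n%:R * ((mag x ^+ 2 - n%:R) / 2) + \sum_(i < n) mu 0 i * spin x i).
Proof. by rewrite /cw_weight sum_spin_pairs. Qed.

Definition local_field x i : R := theta / n%:R * (mag x - spin x i) + mu 0 i.

Lemma local_field_flip x i : local_field (flip i x) i = local_field x i.
Proof. by rewrite /local_field mag_flip spin_flip eqxx; congr (_ * _ + _); ring. Qed.

(** As x_i^2 = 1, the quadratic term in S changes linearly in S - x_i, so the energy difference
    depends on the other spins only through the local field. *)
Lemma cw_weight_flip x i : cw_weight theta mu (flip i x) =
  expR (- (2 * (spin x i * local_field x i))) * cw_weight theta mu x.
Proof.
rewrite !cw_weightE -expRD mag_flip; congr expR.
have -> : \sum_j mu 0 j * spin (flip i x) j =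
    \sum_j mu 0 j * spin x j - 2 * (mu 0 i * spin x i).
  rewrite (bigD1 i)//= [in RHS](bigD1 i)//= spin_flip eqxx.
  rewrite [X in _ + X](eq_bigr (fun j => mu 0 j * spin x j)); first by ring.
  by move=> j /negPf ji; rewrite spin_flip ji.
rewrite /local_field; have := spin_mulK (R := R) x i.
set e := spin x i => ee; set c := theta / _; set m := mag x; set N := n%:R.
have -> : (m - 2 * e) ^+ 2 = m ^+ 2 - 4 * (e * m) + 4 * (e * e) by ring.
have -> : e * (c * (m - e) + mu 0 i) = c * (e * m - e * e) + mu 0 i * e by ring.
by rewrite ee; field.
Qed.

Definition resid x i : R := spin x i - tanh (local_field x i).

Definition total_resid x : R := \sum_i resid x i.

Lemma cw_weight_resid_flip x i :
  cw_weight theta mu (flip i x) * resid (flip i x) i = - (cw_weight theta mu x * resid x i).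
Proof.
rewrite cw_weight_flip /resid local_field_flip spin_flip eqxx.
set w := cw_weight _ _ _; set h := local_field _ _.
case: (spinP (R := R) x i) => ->.
  by rewrite mul1r (tanh_flip h); ring.
have := tanh_flip (- h); rewrite tanhN mulN1r !opprK => E.
by rewrite mulrAC -E; ring.
Qed.

(** The weighted residual at i is odd under the flip at i, so only the odd part of [g]
    contributes. *)
Lemma sum_weight_resid_antisym i (g : config n -> R) :
  \sum_x cw_weight theta mu x * resid x i * g x =
  \sum_x cw_weight theta mu x * resid x i * ((g x - g (flip i x)) / 2).
Proof.
pose A := \sum_x cw_weight theta mu x * resid x i * g x.
pose A' := \sum_x cw_weight theta mu x * resid x i * g (flip i x).
have AA' : A = - A'.
  rewrite /A (reindex_inj (inv_inj (flipK i))) -sumrN.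
  by apply: eq_bigr => x _; rewrite cw_weight_resid_flip mulNr.
rewrite -/A; have -> : A = (A - A') / 2 by rewrite {2}AA'; lra.
rewrite -sumrB mulr_suml; apply: eq_bigr => x _; ring.
Qed.

(** The term at i moves by exactly 2, its local field not seeing x_i. Each other local field moves
    by 2 theta / n, which adds at most 2 in total. *)
Lemma total_resid_flip x i : `|total_resid x - total_resid (flip i x)| <= 4.
Proof.
have /andP[th0 th1] := theta01.
have n0 : (0 : R) < n%:R by rewrite ltr0n (leq_ltn_trans _ (ltn_ord i)).
rewrite -sumrB (bigD1 i)//=; apply: (le_trans (ler_normD _ _)).
have -> : 4 = 2 + 2 :> R by ring.
apply: lerD.
  rewrite /resid local_field_flip spin_flip eqxx.
  rewrite (_ : _ - _ - _ = 2 * spin x i); last by ring.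
  by case: (spinP (R := R) x i) => ->; rewrite ?mulrN ?normrN mulr1 ger0_norm.
apply: (le_trans (ler_norm_sum _ _ _)).
apply: (@le_trans _ _ (\sum_(j < n | j != i) 2 / n%:R)).
  apply: ler_sum => j ji; rewrite /resid spin_flip (negPf ji).
  rewrite opprB addrC addrA subrK distrC.
  apply: (le_trans (tanh_lipschitz _ _)).
  rewrite /local_field mag_flip spin_flip (negPf ji).
  rewrite (_ : _ - _ = theta / n%:R * (2 * spin x i)); last by ring.
  rewrite normrM ger0_norm ?divr_ge0//.
  rewrite mulrAC ler_pM2r ?invr_gt0//.
  have -> : `|2 * spin x i| = 2 :> R.
    by case: (spinP (R := R) x i) => ->; rewrite ?mulrN ?normrN mulr1 ger0_norm.
  lra.
apply: (@le_trans _ _ (\sum_(j < n) 2 / n%:R)).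
  by rewrite [leRHS](bigD1 i)//= lerDr divr_ge0// ltW.
rewrite sumr_const card_ord -[leLHS]mulr_natr divfK// gt_eqF//.
Qed.

Lemma cw_weight_gt0 x : 0 < cw_weight theta mu x.
Proof. exact: expR_gt0. Qed.

Lemma cw_Z_gt0 : 0 < cw_Z theta mu.
Proof.
rewrite /cw_Z (bigD1 [ffun=> true])//= ltr_pwDl ?cw_weight_gt0//.
by apply: sumr_ge0 => x _; rewrite ltW// cw_weight_gt0.
Qed.

Lemma norm_resid_le2 x i : `|resid x i| <= 2.
Proof.
apply: (le_trans (ler_normB _ _)); have := norm_tanh_lt1 (local_field x i).
by case: (spinP (R := R) x i) => ->; rewrite ?normrN normr1; lra.
Qed.

(** Write D^2 as the sum over i of the residual at i times D, and antisymmetrize D in x_i: each i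
    costs at most 2 (residual) times 4 / 2 (half the change of D). *)
Lemma second_moment_total_resid :
  \sum_x cw_weight theta mu x * total_resid x ^+ 2 <= 4 * n%:R * cw_Z theta mu.
Proof.
have -> : \sum_x cw_weight theta mu x * total_resid x ^+ 2 =
    \sum_i \sum_x cw_weight theta mu x * resid x i * total_resid x.
  rewrite exchange_big /=; apply: eq_bigr => x _.
  by rewrite -mulr_suml -mulr_sumr expr2 mulrA.
apply: (@le_trans _ _ (\sum_(i < n) 4 * cw_Z theta mu)); last first.
  by rewrite sumr_const card_ord -[leLHS]mulr_natr mulrAC.
apply: ler_sum => i _; rewrite sum_weight_resid_antisym mulr_sumr.
apply: ler_sum => x _; rewrite -mulrA [leRHS]mulrC ler_pM2l ?cw_weight_gt0//.
apply: (le_trans (ler_norm _)); rewrite normrM normf_div (ger0_norm (_ : 0 <= 2))//.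
have -> : 4 = 2 * (4 / 2) :> R by field.
by rewrite ler_pM ?norm_resid_le2// ?ler_pM2r ?total_resid_flip// divr_ge0.
Qed.

Lemma cw_prob_chebyshev (A : pred (config n)) (c : R) : 0 < c ->
  (forall x, A x -> c <= `|total_resid x|) ->
  cw_prob theta mu A <= 4 * n%:R / c ^+ 2.
Proof.
move=> c0 Ac; rewrite /cw_prob /cw_pmf -mulr_suml ler_pdivrMr ?cw_Z_gt0//.
rewrite mulrAC ler_pdivlMr ?exprn_gt0//.
apply: le_trans second_moment_total_resid; rewrite mulr_suml.
rewrite [leRHS](bigID A)/= -[leLHS]addr0 lerD//.
  apply: ler_sum => x /Ac cx; rewrite ler_pM2l ?cw_weight_gt0//.
  by rewrite -[leRHS]real_normK ?num_real// ler_pXn2r// nnegrE ltW.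
by apply: sumr_ge0 => x _; rewrite mulr_ge0 ?sqr_ge0// ltW// cw_weight_gt0.
Qed.

Lemma total_resid_le x r : (0 < n)%N -> mag x <= r -> 0 <= r ->
  total_resid x <= r + theta - \sum_i tanh (mu 0 i).
Proof.
move=> n0 xr r0; have /andP[th0 th1] := theta01.
have N0 : (0 : R) < n%:R by rewrite ltr0n.
have tn0 : 0 <= theta / n%:R by rewrite divr_ge0.
(* Truncating S at 0 keeps the shift nonpositive, as [tanh_addr_ge] requires; the -1 pays for
   removing x_i from S. *)
pose z := theta / n%:R * (Num.min (mag x) 0 - 1).
have zs i : tanh (mu 0 i) + z <= tanh (local_field x i).
  rewrite /local_field [X in _ <= tanh X]addrC; apply: tanh_addr_ge; rewrite /z.
    rewrite ler_wpM2l// lerB// ?ge_min ?lexx//.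
    by case: (spinP (R := R) x i) => ->; lra.
  rewrite mulr_ge0_le0//.
  have : Num.min (mag x) 0 <= 0 by rewrite ge_min lexx orbT.
  lra.
have : \sum_(i < n) (tanh (mu 0 i) + z) <= \sum_i tanh (local_field x i).
  exact: ler_sum.
rewrite big_split /= sumr_const card_ord -[z *+ _]mulr_natr /z mulrAC divfK ?gt_eqF//.
rewrite /total_resid sumrB -/(mag x) => H.
(* For theta < 1 the truncated term costs no more than min (S, 0), and S - min (S, 0) is the
   positive part of S, at most r. *)
have : theta * (Num.min (mag x) 0 - 1) >= theta * -1 + Num.min (mag x) 0.
  have : Num.min (mag x) 0 <= 0 by rewrite ge_min lexx orbT.
  nra.
have : mag x - Num.min (mag x) 0 <= r.
  by case: (leP (mag x) 0); lra.
lra.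
Qed.

Lemma total_resid_ge x : (0 < n)%N -> 0 <= mag x ->
  (1 - theta) * mag x - theta - \sum_i tanh (mu 0 i) <= total_resid x.
Proof.
move=> n0 x0; have /andP[th0 th1] := theta01.
have N0 : (0 : R) < n%:R by rewrite ltr0n.
have tn0 : 0 <= theta / n%:R by rewrite divr_ge0.
pose z := theta / n%:R * (mag x + 1).
have zs i : tanh (local_field x i) <= tanh (mu 0 i) + z.
  rewrite /local_field [X in tanh X <= _]addrC; apply: tanh_addr_le; rewrite /z.
    rewrite ler_wpM2l// lerD2l.
    by case: (spinP (R := R) x i) => ->; lra.
  by rewrite mulr_ge0// addr_ge0.
have : \sum_i tanh (local_field x i) <= \sum_(i < n) (tanh (mu 0 i) + z).
  exact: ler_sum.
rewrite big_split /= sumr_const card_ord -[z *+ _]mulr_natr /z mulrAC divfK ?gt_eqF//.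
rewrite /total_resid sumrB -/(mag x); lra.
Qed.

Lemma cw_pmf_ge0 x : 0 <= cw_pmf theta mu x.
Proof. by rewrite divr_ge0 ?ltW ?cw_Z_gt0 ?cw_weight_gt0. Qed.

Lemma cw_prob_ge0 (A : pred (config n)) : 0 <= cw_prob theta mu A.
Proof. by apply: sumr_ge0 => x _; exact: cw_pmf_ge0. Qed.

Lemma cw_prob_predC (A : pred (config n)) :
  cw_prob theta mu A + cw_prob theta mu (predC A) = 1.
Proof.
rewrite -(divff (lt0r_neq0 cw_Z_gt0)) {2}/cw_Z mulr_suml.
by rewrite [RHS](bigID A).
Qed.

End Model.

(** * Risk bounds at fixed n, below for every test and above for the mean test *)

Section FiniteRisk.
Context {R : realType} {n : nat}.
Variables (theta : R) (s : nat) (B : R).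
Hypothesis theta01 : 0 <= theta < 1.
Hypothesis n_gt0 : (0 < n)%N.
Hypothesis s_le_n : (s <= n)%N.
Hypothesis B_gt0 : 0 < B.
Implicit Types (x : config n) (sg : 'S_n) (T : config n -> bool).

(** The support is the image under [sg] of the first s indices, so a uniform permutation yields a
    uniform s-subset, in the form suited to [sum_perm_prod_le]. *)
Definition planted sg : 'rV[R]_n := \row_i if ((sg^-1)%g i < s)%N then B else 0.

Lemma planted_Xi sg : Xi s B (planted sg).
Proof.
have E i : (i \in supp (planted sg)) = ((sg^-1)%g i < s)%N.
  by rewrite inE mxE; case: ifP => _; rewrite ?eqxx// gt_eqF.
split=> [|i]; last by rewrite E mxE => ->.
rewrite -sum1_card (eq_bigl _ _ E) (reindex_inj (@perm_inj _ sg)) /=.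
under eq_bigl do rewrite permK.
by rewrite -(big_ord_widen _ (fun=> 1%N) s_le_n) sum1_card card_ord.
Qed.

Lemma sum_tanh_Xi_ge (mu : 'rV[R]_n) : Xi s B mu ->
  s%:R * tanh B <= \sum_i tanh (mu 0 i).
Proof.
move=> [cmu muB]; rewrite (bigID (mem (supp mu)))/= [X in _ + X]big1 => [|i]; last first.
  by rewrite inE negbK => /eqP ->; rewrite tanh0.
rewrite addr0 mulr_natl -cmu -sumr_const; apply: ler_sum => i imu.
by rewrite tanh_le// muB.
Qed.

Lemma sum_tanh_planted sg : \sum_i tanh (planted sg 0 i) = s%:R * tanh B.
Proof.
rewrite (reindex_inj (@perm_inj _ sg)) /=.
under eq_bigr do rewrite mxE permK (fun_if tanh) tanh0.
by rewrite -big_mkcond -(big_ord_widen _ (fun=> tanh B) s_le_n) sumr_const card_ord mulr_natl.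
Qed.

Lemma cw_weight_split (mu : 'rV[R]_n) x :
  cw_weight theta mu x = cw_weight theta 0 x * \prod_i expR (mu 0 i * spin x i).
Proof.
rewrite /cw_weight expRD expR_sum; congr (_ * _).
by congr expR; rewrite [X in _ + X]big1 ?addr0// => i _; rewrite mxE mul0r.
Qed.

Let tilt sg x : R := \prod_(k < n | (k < s)%N) (1 + tanh B * spin x (sg k)).

Lemma spin_tilt_ge0 x i : 0 <= 1 + tanh B * spin x i.
Proof.
have := tanh_lt1 B; have := tanh_gtN1 B.
by case: (spinP (R := R) x i) => ->; lra.
Qed.

(** The planted weight is (cosh B)^s times [tilt] times the null weight. Griffiths' inequality says
    that the partition function grows by at least (cosh B)^s, so this factor cancels. *)
Lemma cw_pmf_planted_le sg x :
  cw_pmf theta (planted sg) x <= cw_pmf theta 0 x * tilt sg x.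
Proof.
pose c : R := (expR B + expR (- B)) / 2.
pose K : R := \prod_(k < n | (k < s)%N) c.
have c0 : 0 < c by rewrite divr_gt0// expR_cosh_gt0.
have K0 : 0 < K by apply: prodr_gt0.
have W z : cw_weight theta (planted sg) z = K * (tilt sg z * cw_weight theta 0 z).
  rewrite cw_weight_split mulrC mulrA; congr (_ * _).
  rewrite (reindex_inj (@perm_inj _ sg)) /= -[RHS]big_split /= [RHS]big_mkcond /=.
  apply: eq_bigr => k _; rewrite mxE permK; case: ifP => _; last by rewrite mul0r expR0.
  exact: expR_sign (spinP _ _).
have Z : K * cw_Z theta (0 : 'rV[R]_n) <= cw_Z theta (planted sg).
  have -> : cw_Z theta (planted sg) = K * \sum_x tilt sg x * cw_weight theta 0 x.
    by rewrite mulr_sumr; apply: eq_bigr => z _; rewrite W.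
  rewrite ler_pM2l//.
  have tB : 0 <= tanh B by rewrite ltW// tanh_gt0.
  have th0 : 0 <= theta by case/andP: theta01.
  have [_] := ferromagnetic_prod _ _
    [seq sg k | k : 'I_n <- index_enum _ & (k < s)%N] tB (ferromagnetic_cw _ th0).
  by congr (_ <= _); apply: eq_bigr => z _; rewrite big_map big_filter.
have Z0 := cw_Z_gt0 theta (0 : 'rV[R]_n).
rewrite /cw_pmf W ler_pdivrMr ?cw_Z_gt0//.
have -> : cw_weight theta 0 x / cw_Z theta (0 : 'rV[R]_n) * tilt sg x * cw_Z theta (planted sg) =
  (tilt sg x * cw_weight theta 0 x) * (cw_Z theta (planted sg) / cw_Z theta (0 : 'rV[R]_n)) by ring.
rewrite mulrC ler_wpM2l ?ler_pdivlMr//.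
apply: mulr_ge0; last exact/ltW/cw_weight_gt0.
by apply: prodr_ge0 => k _; exact: spin_tilt_ge0.
Qed.

Lemma sum_cw_pmf_planted_le x :
  \sum_(sg : 'S_n) cw_pmf theta (planted sg) x <=
  (cw_pmf theta 0 x * expR (s%:R * (tanh B * xbar x))) * \sum_(sg : 'S_n) 1.
Proof.
have p0 := cw_pmf_ge0 theta (0 : 'rV[R]_n) x.
apply: (@le_trans _ _ (\sum_(sg : 'S_n) cw_pmf theta 0 x * tilt sg x)).
  by apply: ler_sum => sg _; exact: cw_pmf_planted_le.
rewrite -mulr_sumr -mulrA ler_wpM2l//.
apply: (le_trans (sum_perm_prod_le _ (spin_tilt_ge0 x) _ s_le_n)).
rewrite ler_wpM2r ?sumr_ge0// expRM_natl.
have n0 : (n%:R : R) != 0 by rewrite pnatr_eq0 -lt0n.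
(* The base must be nonnegative before 1 + u <= exp u is raised to the power s. *)
have m0 : 0 <= n%:R^-1 * \sum_i (1 + tanh B * spin x i).
  by rewrite mulr_ge0 ?invr_ge0// sumr_ge0// => i _; exact: spin_tilt_ge0.
have mE : n%:R^-1 * \sum_i (1 + tanh B * spin x i) = 1 + tanh B * xbar x.
  by rewrite big_split /= sumr_const card_ord -mulr_sumr /xbar; field.
by rewrite mE in m0 *; rewrite lerXn2r ?nnegrE ?expR_ge0 ?expR_ge1Dx.
Qed.

Lemma cw_prob_le1 (mu : 'rV[R]_n) (A : pred (config n)) : cw_prob theta mu A <= 1.
Proof. by rewrite -(cw_prob_predC theta mu A) lerDl cw_prob_ge0. Qed.

Lemma cw_prob_le_risk (mu : 'rV[R]_n) T : Xi s B mu ->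
  cw_prob theta mu (fun x => ~~ T x) <= risk theta s B T.
Proof.
move=> muXi; rewrite /risk -[leLHS]add0r lerD ?cw_prob_ge0//.
apply: ub_le_sup; last by exists mu.
by exists 1 => _ [nu _ <-]; exact: cw_prob_le1.
Qed.

Lemma cw_prob0_le_risk T : cw_prob theta (0 : 'rV[R]_n) T <= risk theta s B T.
Proof.
rewrite /risk lerDl; apply: le_trans (cw_prob_ge0 theta (planted 1%g) (fun x => ~~ T x)) _.
apply: ub_le_sup; last by exists (planted 1%g) => //; exact: planted_Xi.
by exists 1 => _ [nu _ <-]; exact: cw_prob_le1.
Qed.

(** The average power over the prior is at least 1 - risk. On S <= r it is at most the likelihood
    ratio bound times the type I error; on S > r the hypothesis on [c] forces D >= c, and Chebyshev
    applies. *)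
Lemma risk_lower_bound T (r c : R) : 0 <= r -> 0 < c ->
  c + s%:R * tanh B + theta <= (1 - theta) * r ->
  1 <= (1 + expR (s%:R * tanh B * r / n%:R)) * risk theta s B T + 4 * n%:R / c ^+ 2.
Proof.
move=> r0 c0 rc; set M := expR _; set rho := risk _ _ _ _.
pose N : R := \sum_(sg : 'S_n) 1.
have N0 : 0 < N by rewrite /N sumr_const pmulrn_lgt0// card_Sn fact_gt0.
have n0 : (0 : R) < n%:R by rewrite ltr0n.
have th1 : 0 < 1 - theta by case/andP: theta01 => _; lra.
have lo : N * (1 - rho) <= \sum_(sg : 'S_n) cw_prob theta (planted sg) T.
  rewrite mulr_suml; apply: ler_sum => sg _; rewrite mul1r.
  rewrite lerBlDr -(cw_prob_predC theta (planted sg) T) lerD2l.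
  exact/cw_prob_le_risk/planted_Xi.
have hi : \sum_(sg : 'S_n) cw_prob theta (planted sg) T <=
    N * (M * cw_prob theta (0 : 'rV[R]_n) T) + N * (4 * n%:R / c ^+ 2).
  apply: (@le_trans _ _ (\sum_(sg : 'S_n)
      (\sum_(x | T x && (mag x <= r)) cw_pmf theta (planted sg) x +
       cw_prob theta (planted sg) (fun x => r < mag x)))).
    apply: ler_sum => sg _; rewrite /cw_prob [leLHS](bigID (fun x => mag x <= r))/= lerD2l.
    rewrite [leLHS]big_mkcond [leRHS]big_mkcond; apply: ler_sum => x _ /=.
    rewrite -ltNge; have := cw_pmf_ge0 theta (planted sg) x.
    by case: (T x); case: ltP.
  rewrite big_split lerD//=; last first.
    rewrite mulr_suml; apply: ler_sum => sg _; rewrite mul1r.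
    apply: cw_prob_chebyshev => // x rx.
    have x0 : 0 <= mag x :> R by rewrite (le_trans r0) 1?ltW.
    apply: le_trans (ler_norm _); apply: le_trans (total_resid_ge _ _ theta01 x n_gt0 x0).
    rewrite sum_tanh_planted.
    have := rx; rewrite -(ltr_pM2l th1); lra.
  rewrite exchange_big /= /cw_prob !mulr_sumr [leRHS](bigID (fun x => mag x <= r))/=.
  rewrite -[leLHS]addr0 lerD//; last first.
    apply: sumr_ge0 => x _; apply: mulr_ge0; first exact: ltW.
    by apply: mulr_ge0; [exact: expR_ge0|exact: cw_pmf_ge0].
  apply: ler_sum => x /andP[_ xr]; apply: (le_trans (sum_cw_pmf_planted_le x)).
  rewrite -/N mulrC ler_pM2l// mulrC ler_wpM2r//.
    exact: cw_pmf_ge0.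
  rewrite ler_expR (_ : _ * (_ * _) = s%:R * tanh B * mag x / n%:R); last first.
    by rewrite /xbar -/(mag x); ring.
  rewrite ler_pM2r ?invr_gt0//.
  by rewrite ler_wpM2l// mulr_ge0// tanh_ge0// ltW.
have := le_trans lo hi; rewrite -mulrDr ler_pM2l// => H.
have : M * cw_prob theta (0 : 'rV[R]_n) T <= M * rho.
  by rewrite ler_wpM2l ?expR_ge0 ?cw_prob0_le_risk.
lra.
Qed.

Lemma risk_mean_test_le (K L : R) : 0 < K -> K + 1 <= (1 - theta) * L ->
  Num.sqrt n%:R * L + (K + 1) * Num.sqrt n%:R <= s%:R * tanh B ->
  risk theta s B (fun x => L <= Num.sqrt n%:R * xbar x) <= 8 / K ^+ 2.
Proof.
move=> K0 KL sL; have /andP[th0 th1] := theta01.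
have n0 : (0 : R) < n%:R by rewrite ltr0n.
set q := Num.sqrt n%:R in sL *.
have q1 : 1 <= q by rewrite -(sqrtr1 R) ler_sqrt// ler1n.
have q0 : 0 < q by lra.
have qq : q ^+ 2 = n%:R by rewrite sqr_sqrtr// ltW.
have magE x : q * xbar x = mag x / q.
  by rewrite /xbar -/(mag x) -qq; field; rewrite gt_eqF.
have L0 : 0 < L by nra.
(* Each error gets a Chebyshev bound at level K q; the +1 in K + 1 absorbs theta, since theta < 1 <=
   q. *)
have boundE : 8 / K ^+ 2 = 4 * n%:R / (K * q) ^+ 2 + 4 * n%:R / (K * q) ^+ 2 :> R.
  by rewrite -qq; field; rewrite !gt_eqF.
have Kq : 0 < K * q by rewrite mulr_gt0.
rewrite /risk boundE lerD//.
  apply: cw_prob_chebyshev => // x; rewrite magE ler_pdivlMr// => Lx.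
  have x0 : 0 <= mag x :> R by rewrite (le_trans _ Lx)// mulr_ge0 ?ltW.
  apply: le_trans (ler_norm _); apply: le_trans (total_resid_ge _ _ theta01 x n_gt0 x0).
  rewrite [X in _ - X]big1 => [|i _]; last by rewrite mxE tanh0.
  have : (1 - theta) * (L * q) <= (1 - theta) * mag x by rewrite ler_wpM2l// subr_ge0 ltW.
  have : (K + 1) * q <= (1 - theta) * L * q by rewrite ler_pM2r.
  lra.
apply: ge_sup; first by eexists; exists (planted 1%g); first exact: planted_Xi.
move=> _ [mu muXi <-]; apply: cw_prob_chebyshev => // x.
rewrite magE -ltNge ltr_pdivrMr// => /ltW xL.
have Lq0 : 0 <= L * q by rewrite mulr_ge0 ?ltW.
rewrite -normrN; apply: le_trans (ler_norm _).
have := total_resid_le _ mu theta01 x _ n_gt0 xL Lq0; have := sum_tanh_Xi_ge _ muXi.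
lra.
Qed.

End FiniteRisk.

(** * Asymptotics: vanishing limsup of the risk, and the two regimes *)

Lemma risk_ge0 {R : realType} n (theta : R) s (B : R) (T : config n -> bool) :
  0 <= risk theta s B T.
Proof.
rewrite addr_ge0 ?cw_prob_ge0//; set E := [set _ | _ in _].
(* With no admissible signal, [sup] takes its default value 0, so nonnegativity holds for all s and
   n. *)
have [->|/set0P[_ [mu muXi _]]] := eqVneq E set0; first by rewrite sup0.
apply: le_trans (cw_prob_ge0 theta mu (fun x => ~~ T x)) _.
apply: ub_le_sup; last by exists mu.
by exists 1 => _ [nu _ <-]; exact: cw_prob_le1.
Qed.

Lemma asymptotically_powerfulP (R : realType) (theta : R) (s : nat -> nat)
    (B : nat -> R) (T : forall n, config n -> bool) :
  asymptotically_powerful theta s B T <->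
  forall e : R, 0 < e -> \forall n \near \oo, risk theta (s n) (B n) (T n) < e.
Proof.
pose rho n := risk theta (s n) (B n) (T n).
have rho_norm n : `|0 - rho n| = rho n by rewrite sub0r normrN ger0_norm// risk_ge0.
suff -> : asymptotically_powerful theta s B T <-> rho n @[n --> \oo] --> (0 : R).
  rewrite cvgrPdist_lt; split=> H e e0; have := H e e0;
  by apply: filterS => n; rewrite rho_norm.
split=> [H|H].
  suff /fine_cvgP[]: (rho n)%:E @[n --> \oo] --> (0 : \bar R) by [].
  apply: limn_esup_le_cvg => [|n]; last by rewrite lee_fin risk_ge0.
  by rewrite -[leRHS]H.
rewrite /asymptotically_powerful -/(EFin \o rho).
have /cvg_limn_einf_sup[_ ->//] : (EFin \o rho) n @[n --> \oo] --> (0 : \bar R).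
by apply: cvg_EFin => //; exact: nearW.
Qed.

Theorem theorem1 (R : realType) (theta : R) (htheta : 0 <= theta < 1)
    (s : nat -> nat) (hs : forall n, (0 < n)%N -> (1 <= s n <= n)%N)
    (B : nat -> R) (hB : forall n, (0 < n)%N -> 0 < B n) :
  (((fun n => Num.sqrt n%:R) : nat -> R)
      =o_\oo (fun n => (s n)%:R * tanh (B n)) ->
   forall L : nat -> R,
     L n @[n --> \oo] --> +oo ->
     L =o_\oo (fun n => (Num.sqrt n%:R)^-1 * ((s n)%:R * tanh (B n))) ->
     asymptotically_powerful theta s B
       (fun n (x : config n) => L n <= Num.sqrt n%:R * xbar x))
  /\
  (((fun n => (s n)%:R * tanh (B n)) : nat -> R)
      =O_\oo (fun n => Num.sqrt n%:R) ->
   ~ exists T : forall n, config n -> bool, asymptotically_powerful theta s B T).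
Proof.
have /andP[th0 th1] := htheta; have d0 : 0 < 1 - theta by lra.
have t0 n : (0 < n)%N -> 0 < tanh (B n) by move=> /hB; exact: tanh_gt0.
split.
  move=> /eqoP st_big L /cvgryPge L_big /eqoP L_small.
  (* This choice gives K >= 1 and e K = e + 9 > 8, hence 8 / K^2 < e. *)
  apply/asymptotically_powerfulP => e e0; pose K := 1 + 9 / e.
  have K0 : 0 < K by rewrite addr_gt0// divr_gt0.
  have K1 : 0 < K + 1 by lra.
  have inv0 : 0 < (2 * (K + 1))^-1 by rewrite invr_gt0 mulr_gt0.
  have half0 : 0 < 2^-1 :> R by rewrite invr_gt0.
  near=> n; have n0 : (0 < n)%N by near: n; exact: nbhs_infty_gt.
  have /andP[s1 sn] := hs n n0.
  have q0 : (0 : R) < Num.sqrt n%:R by rewrite sqrtr_gt0 ltr0n.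
  have st0 : 0 <= (s n)%:R * tanh (B n) by rewrite mulr_ge0// ltW// t0.
  apply: le_lt_trans (risk_mean_test_le _ _ _ htheta n0 sn (hB n n0) K _ K0 _ _) _.
  - rewrite mulrC -ler_pdivrMr//; near: n; exact: L_big.
  (* The signal s tanh B is split in halves: one dominates (K + 1) sqrt n, the other sqrt n L_n. *)
  - have H1 : `|Num.sqrt n%:R| <= (2 * (K + 1))^-1 * `|(s n)%:R * tanh (B n)|.
      by near: n; exact: st_big.
    have H2 : `|L n| <= 2^-1 * `|(Num.sqrt n%:R)^-1 * ((s n)%:R * tanh (B n))|.
      by near: n; exact: L_small.
    move: H1 H2; set st := _ * tanh _ in st0 *; set q := Num.sqrt _ in q0 *.
    rewrite [`|_^-1 * _|]normrM normfV (gtr0_norm q0) (ger0_norm st0).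
    rewrite ler_pdivlMl ?mulr_gt0// mulrCA ler_pdivlMl// => H1 H2.
    have := ler_norm (L n); rewrite -(ler_pM2l q0); lra.
  - rewrite ltr_pdivrMr ?exprn_gt0//.
    have : e * K = e + 9 by rewrite /K; field; rewrite gt_eqF.
    have : 1 <= K by rewrite lerDl divr_ge0// ltW.
    nra.
move=> /eqO_exP[C C0 st_le] [T] /asymptotically_powerfulP powerful.
(* The cutoff is r = M sqrt n. In units of sqrt n, C + 5 covers 4 for the Chebyshev level, C for s
   tanh B and 1 for theta. *)
pose M := (C + 5) / (1 - theta).
have M0 : 0 < M by rewrite divr_gt0// addr_gt0.
pose G := 1 + expR (C * M).
have G0 : 0 < G by rewrite addr_gt0// expR_gt0.
suff: \forall n \near \oo, False by case=> N _ /(_ N (leqnn N)).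
near=> n; have n0 : (0 < n)%N by near: n; exact: nbhs_infty_gt.
have /andP[s1 sn] := hs n n0.
have q1 : (1 : R) <= Num.sqrt n%:R by rewrite -[leLHS]sqrtr1 ler_sqrt ?ler1n.
have qq : Num.sqrt n%:R ^+ 2 = n%:R :> R by rewrite sqr_sqrtr.
have st0 : 0 <= (s n)%:R * tanh (B n) by rewrite mulr_ge0// ltW// t0.
have H : `|(s n)%:R * tanh (B n)| <= C * `|Num.sqrt n%:R| by near: n.
(* [G] bounds the factor of the risk in [risk_lower_bound], so the risk term stays below 1/2 while
   the Chebyshev term is 1/4: their sum cannot reach 1. *)
have small : risk theta (s n) (B n) (T n) < (2 * G)^-1.
  by near: n; apply: powerful; rewrite invr_gt0 mulr_gt0.
have := risk_lower_bound _ _ _ htheta n0 sn (hB n n0) (T n)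
  (M * Num.sqrt n%:R) (4 * Num.sqrt n%:R).
move: q1 qq st0 H small; set st := _ * tanh _; set q := Num.sqrt _; set rho := risk _ _ _ _.
move=> q1 qq st0; have q0 : 0 < q by lra.
rewrite (gtr0_norm q0) (ger0_norm st0) => stC small.
have MqE : (1 - theta) * (M * q) = (C + 5) * q by rewrite /M; field; rewrite gt_eqF.
rewrite MqE.
have Mq0 : 0 <= M * q by rewrite mulr_ge0// ltW.
have q40 : 0 < 4 * q by rewrite mulr_gt0.
move=> /(_ Mq0 q40); have rng : 4 * q + st + theta <= (C + 5) * q by lra.
move=> /(_ rng).
have EG : 1 + expR (st * (M * q) / n%:R) <= G.
  rewrite lerD2l ler_expR ler_pdivrMr ?ltr0n// -qq.
  have : st * (M * q) <= C * q * (M * q) by rewrite ler_wpM2r// mulr_ge0// ltW.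
  lra.
have -> : 4 * n%:R / (4 * q) ^+ 2 = 4^-1 :> R by rewrite -qq; field; rewrite gt_eqF.
have rho0 : 0 <= rho by exact: risk_ge0.
have : rho * G < 2^-1 by rewrite -ltr_pdivlMr// -invfM.
have := ler_wpM2r rho0 EG; lra.
Unshelve. all: by end_near.
Qed.
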